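(* Let $N$ be the smallest normal subgroup of $W(\widetilde{R}_A)$ containing $\widetilde{\tau}_1:=\widetilde{r}_1\widetilde{r}_{1^*}$, and let $p:W(\widetilde{R}_A)\to W(R_A)$ be the natural surjection. Then there is an exact sequence of groups $$\{1\}\longrightarrow N\longrightarrow W(\widetilde{R}_A)\stackrel{p}{\longrightarrow}W(R_A)\longrightarrow\{1\}.$$ In particular, there is an isomorphism of groups $$W(\widetilde{R}_A)\cong W(R_A)\ltimes\bigl(K_0(R_A)/\mathrm{rad}(I_{R_A})\bigr),$$ the semi-direct product being formed with respect to the natural action of $W(R_A)$ on $K_0(R_A)/\mathrm{rad}(I_{R_A})$.
   Context: Let $r\ge3$ and let $A=(a_1,\dots,a_r)$ be a tuple of integers $\ge2$. **The root system $R_A$.** $T_A=\{1\}\sqcup\{(i,j):1\le i\le r,\ 1\le j\le a_i-1\}$. $K_0(R_A)$ is the free abelian group with basis $\{\alpha_v\}_{v\in T_A}$ (it is the Grothendieck group of the bounded derived category of finite dimensional representations of the star quiver of type $A$, and $\alpha_v$ is the class of the simple module at $v$), with symmetric bilinear form $I_{R_A}$ (the symmetrized Euler form) given by $I_{R_A}(\alpha_v,\alpha_v)=2$, $I_{R_A}(\alpha_1,\alpha_{(i,1)})=-1$, $I_{R_A}(\alpha_{(i,j)},\alpha_{(i,j+1)})=-1$, and $0$ for all other pairs of distinct basis elements. For $v\in T_A$, $r_v(\lambda)=\lambda-I_{R_A}(\lambda,\alpha_v)\alpha_v$, and $W(R_A)=\langle r_v\mid v\in T_A\rangle\subset\mathrm{Aut}(K_0(R_A),I_{R_A})$.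 $\mathrm{rad}(I_{R_A})=\{\lambda: I_{R_A}(\lambda,\cdot)=0\}$. **The root system $\widetilde{R}_A$.** $\widetilde{T}_A=T_A\sqcup\{1^*\}$. $K_0(\widetilde{R}_A)$ is the free abelian group with basis $\{\widetilde{\alpha}_v\}_{v\in\widetilde{T}_A}$ (the Grothendieck group of the bounded derived category of the octopus algebra, equivalently of coherent sheaves on the orbifold projective line $\mathbb{P}^1_{A,\Lambda}$), with symmetric bilinear form $I_{\widetilde{R}_A}(\widetilde{\alpha}_v,\widetilde{\alpha}_{v'})=I_{R_A}(\alpha_v,\alpha_{v'})$ for $v,v'\in T_A$, $I_{\widetilde{R}_A}(\widetilde{\alpha}_{1^*},\widetilde{\alpha}_{1^*})=2$, $I_{\widetilde{R}_A}(\widetilde{\alpha}_{1^*},\widetilde{\alpha}_1)=2$, $I_{\widetilde{R}_A}(\widetilde{\alpha}_{1^*},\widetilde{\alpha}_{(i,1)})=-1$, $I_{\widetilde{R}_A}(\widetilde{\alpha}_{1^*},\widetilde{\alpha}_{(i,j)})=0$ for $j\ge2$. For $v\in\widetilde{T}_A$, $\widetilde{r}_v(\lambda)=\lambda-I_{\widetilde{R}_A}(\lambda,\widetilde{\alpha}_v)\widetilde{\alpha}_v$, and $W(\widetilde{R}_A)=\langle\widetilde{r}_v\mid v\in\widetilde{T}_A\rangle\subset\mathrm{Aut}(K_0(\widetilde{R}_A),I_{\widetilde{R}_A})$. **The map $p$.** The element $\delta:=\widetilde{\alpha}_{1^*}-\widetilde{\alpha}_1$ lies in the radical of $I_{\widetilde{R}_A}$;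 the projection $K_0(\widetilde{R}_A)\to K_0(\widetilde{R}_A)/\mathbb{Z}\delta\cong K_0(R_A)$ induces the surjective homomorphism $p:W(\widetilde{R}_A)\to W(R_A)$ with $p(\widetilde{r}_1)=p(\widetilde{r}_{1^*})=r_1$, $p(\widetilde{r}_v)=r_v$ for $v\in T_A$. *)

(* Defs.v *)
From HB Require Import structures.
From mathcomp Require Import all_boot all_order all_algebra.
From mathcomp Require Import boolp ring.

Set Implicit Arguments.
Unset Strict Implicit.
Unset Printing Implicit Defensive.

Import GRing.Theory.
Local Open Scope ring_scope.
Local Open Scope quotient_scope.

Section TrivialGroup.
Let mulu (_ _ : unit) : unit := tt.
Let invu (_ : unit) : unit := tt.
Let muluA : associative mulu. Proof. by []. Qed.
Let mul1u : left_id tt mulu. Proof. by case. Qed.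
Let mulu1 : right_id tt mulu. Proof. by case. Qed.
Let mulVu : left_inverse tt invu mulu. Proof. by []. Qed.
Let muluV : right_inverse tt invu mulu. Proof. by []. Qed.
HB.instance Definition _ := isGroup.Build unit muluA mul1u mulu1 mulVu muluV.
End TrivialGroup.

Section Subgroup.
Variables (G : groupType) (S : groupClosed G).

Record subgroup := Subgroup { subgroup_val : G; _ : subgroup_val \in S }.

HB.instance Definition _ := [isSub for subgroup_val].
HB.instance Definition _ := [Choice of subgroup by <:].

Let subgroup_closed : group_closed S.
Proof. by split=> [|x y xS yS]; [exact: gpred1 | exact: gpredF]. Qed.

HB.instance Definition _ :=
  SubChoice_isSubGroup.Build G _ subgroup subgroup_closed.

End Subgroup.

Definition incl (G : groupType) (S : groupClosed G) :
  {multiplicative subgroup S -> G} := val.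

Section Generated.
Variables (G : groupType) (A : G -> Prop).

Definition generated : {pred G} := fun x =>
  `[< forall H : {pred G}, group_closed H ->
        (forall a, A a -> a \in H) -> x \in H >].

(* (h ^ g)%g is the conjugate g^-1 * h * g. *)
Definition normal_closure : {pred G} := fun x =>
  `[< forall H : {pred G}, group_closed H ->
        (forall h g, h \in H -> (h ^ g)%g \in H) ->
        (forall a, A a -> a \in H) -> x \in H >].

Let generated_closed : group_closed generated.
Proof.
split; first by apply/asboolP => H [].
move=> x y /asboolP xP /asboolP yP; apply/asboolP => H Hc HA.
by apply: Hc.2; [apply: xP | apply: yP].
Qed.

Let normal_closure_closed : group_closed normal_closure.
Proof.
split; first by apply/asboolP => H [].
move=> x y /asboolP xP /asboolP yP; apply/asboolP => H Hc HJ HA.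
by apply: Hc.2; [apply: xP | apply: yP].
Qed.

HB.instance Definition _ :=
  isMulClosed.Build G generated (group_closedM generated_closed).
HB.instance Definition _ := isMul1Closed.Build G generated generated_closed.1.
HB.instance Definition _ :=
  isInvClosed.Build G generated (group_closedV generated_closed).
HB.instance Definition _ :=
  isMulClosed.Build G normal_closure (group_closedM normal_closure_closed).
HB.instance Definition _ :=
  isMul1Closed.Build G normal_closure normal_closure_closed.1.
HB.instance Definition _ :=
  isInvClosed.Build G normal_closure (group_closedV normal_closure_closed).

Lemma mem_generated a : A a -> a \in generated.
Proof. by move=> Aa; apply/asboolP => H _; apply. Qed.

End Generated.

Definition exact_at (G H K : groupType)
    (f : {multiplicative G -> H}) (g : {multiplicative H -> K}) : Prop :=
  forall y : H, g y = 1%g <-> exists x : G, f x = y.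

(* Exactness of 1 -> G -> H -> K -> 1. *)
Definition short_exact (G H K : groupType)
    (f : {multiplicative G -> H}) (g : {multiplicative H -> K}) : Prop :=
  [/\ exact_at (one_fun G : {multiplicative unit -> G}) f,
      exact_at f g &
      exact_at g (one_fun unit : {multiplicative K -> unit})].

Definition isomorphic (G H : groupType) : Prop :=
  exists f : {multiplicative G -> H}, bijective f.

Record group_action (G : groupType) (M : zmodType) := GroupAction {
  act :> G -> M -> M;
  act1 : forall m, act 1%g m = m;
  actM : forall g h m, act (g * h)%g m = act g (act h m);
  actD : forall g m n, act g (m + n) = act g m + act g n }.

Section SemidirectProduct.
Variables (G : groupType) (M : zmodType) (rho : group_action G M).

Definition semidirect (_ : group_action G M) : Type := (G * M)%type.

Let T := semidirect rho.
HB.instance Definition _ := Choice.copy (semidirect rho) (G * M)%type.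

Definition sdmul (x y : T) : T := ((x.1 * y.1)%g, x.2 + rho x.1 y.2).
Definition sdone : T := (1%g, 0).
Definition sdinv (x : T) : T := (x.1^-1%g, - rho x.1^-1%g x.2).

Let act0 g : rho g 0 = 0.
Proof. by apply: (addrI (rho g 0)); rewrite -actD !addr0. Qed.
Let actN g m : rho g (- m) = - rho g m.
Proof. by apply/eqP; rewrite -addr_eq0 -actD addNr act0. Qed.

Let sdmulA : associative sdmul.
Proof. by move=> x y z; congr (_, _); rewrite ?mulgA //= actD actM addrA. Qed.
Let sdmul1 : left_id sdone sdmul.
Proof. by case=> g m; congr (_, _); rewrite /= ?mul1g // act1 add0r. Qed.
Let sd1mul : right_id sdone sdmul.
Proof. by case=> g m; congr (_, _); rewrite /= ?mulg1 // act0 addr0. Qed.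
Let sdmulV : left_inverse sdone sdinv sdmul.
Proof. by case=> g m; congr (_, _); rewrite /= ?mulVg // addNr. Qed.
Let sdVmul : right_inverse sdone sdinv sdmul.
Proof.
case=> g m; congr (_, _); rewrite /= ?mulgV //.
by rewrite actN -actM mulgV act1 subrr.
Qed.

HB.instance Definition _ :=
  isGroup.Build (semidirect rho) sdmulA sdmul1 sd1mul sdmulV sdVmul.

End SemidirectProduct.

(* A lattice with a basis of simple roots, presented by its Gram matrix. *)
Record root_basis := RootBasis {
  vertex : finType;
  gram : vertex -> vertex -> int;
  gram_sym : forall u v, gram u v = gram v u;
  gram_diag : forall v, gram v v = 2 }.

Section Lattice.
Variable D : root_basis.

Definition K0 : zmodType := {ffun vertex D -> int}.

Definition alpha (v : vertex D) : K0 := [ffun u => (u == v)%:Z].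

Definition form (x y : K0) : int := \sum_u \sum_v x u * gram u v * y v.

Lemma formC x y : form x y = form y x.
Proof.
rewrite /form exchange_big; apply: eq_bigr => u _; apply: eq_bigr => v _.
by rewrite -mulrA mulrC (mulrC (gram _ _)) gram_sym.
Qed.

Lemma form_zmod_morphism x : zmod_morphism (form x).
Proof.
move=> y z; rewrite /form -sumrB; apply: eq_bigr => u _.
by rewrite -sumrB; apply: eq_bigr => v _; rewrite !ffunE mulrBr.
Qed.

HB.instance Definition _ x :=
  GRing.isZmodMorphism.Build K0 int (form x) (form_zmod_morphism x).

Lemma form_alphal v x : form (alpha v) x = \sum_w gram v w * x w.
Proof.
rewrite /form (bigD1 v) //= [X in _ + X]big1 ?addr0; last first.
  by move=> u /negPf nuv; rewrite big1 // => w _; rewrite ffunE nuv !mul0r.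
by apply: eq_bigr => w _; rewrite ffunE eqxx mul1r.
Qed.

Lemma form_alpha u v : form (alpha u) (alpha v) = gram u v.
Proof.
rewrite form_alphal (bigD1 v) //= [X in _ + X]big1 ?addr0.
  by rewrite ffunE eqxx mulr1.
by move=> w /negPf nwv; rewrite ffunE nwv mulr0.
Qed.

Lemma mulrz_int (m n : int) : m *~ n = m * n.
Proof. by rewrite -mulrzr intz. Qed.

Lemma K0_mulrzE (x : K0) (n : int) v : (x *~ n) v = x v * n.
Proof.
by rewrite -mulrz_int; case: n => n; rewrite /intmul ?ffunE ffunMnE.
Qed.

Lemma alpha_decomp (x : K0) : x = \sum_u alpha u *~ x u.
Proof.
apply/ffunP => v; rewrite sum_ffunE (bigD1 v) //= [X in _ + X]big1 ?addr0.
  by rewrite K0_mulrzE ffunE eqxx mul1r.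
by move=> w nwv; rewrite K0_mulrzE ffunE eq_sym (negPf nwv) mul0r.
Qed.

Definition is_aut (f : K0 -> K0) : Prop :=
  [/\ {morph f : x y / x + y}, bijective f &
      forall x y, form (f x) (f y) = form x y].

Record aut := Aut { aut_val :> K0 -> K0; _ : `[< is_aut aut_val >] }.

HB.instance Definition _ := [isSub for aut_val].
HB.instance Definition _ := [Choice of aut by <:].

Lemma autP (f : aut) : is_aut f.
Proof. by case: f => f /= /asboolP. Qed.

Definition mk_aut f (fP : is_aut f) : aut := Aut (asboolT fP).

Lemma aut_ext (f g : aut) : (forall x, f x = g x) -> f = g.
Proof. by move=> fg; apply/val_inj/funext. Qed.

Lemma autD (f : aut) : {morph f : x y / x + y}. Proof. by case: (autP f). Qed.

Lemma aut_form (f : aut) x y : form (f x) (f y) = form x y.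
Proof. by case: (autP f). Qed.

Let id_aut : is_aut id.
Proof. by split=> //; exists id. Qed.

Let comp_aut (f g : aut) : is_aut (f \o g).
Proof.
split=> [x y | | x y] /=; rewrite ?autD ?aut_form //.
by apply: bij_comp; case: (autP f); case: (autP g).
Qed.

Let aut_can (f : aut) : {g : K0 -> K0 | cancel f g /\ cancel g f}.
Proof. by apply/cid; case: (autP f) => _ [g fK gK] _; exists g. Qed.

Let inv_aut (f : aut) : is_aut (sval (aut_can f)).
Proof.
case: aut_can => g [fK gK] /=; split; last 2 first.
- by exists f.
- by move=> x y; rewrite -(aut_form f) !gK.
by move=> x y; apply: (can_inj fK); rewrite autD !gK.
Qed.

Definition aut_one : aut := mk_aut id_aut.
Definition aut_mul (f g : aut) : aut := mk_aut (comp_aut f g).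
Definition aut_inv (f : aut) : aut := mk_aut (inv_aut f).

Let aut_mulA : associative aut_mul. Proof. by move=> f g h; apply: aut_ext. Qed.
Let aut_mul1 : left_id aut_one aut_mul. Proof. by move=> f; apply: aut_ext. Qed.
Let aut_1mul : right_id aut_one aut_mul.
Proof. by move=> f; apply: aut_ext. Qed.
Let aut_mulV : left_inverse aut_one aut_inv aut_mul.
Proof. by move=> f; apply: aut_ext => x /=; case: aut_can => g [fK gK] /=. Qed.
Let aut_Vmul : right_inverse aut_one aut_inv aut_mul.
Proof. by move=> f; apply: aut_ext => x /=; case: aut_can => g [fK gK] /=. Qed.

HB.instance Definition _ :=
  isGroup.Build aut aut_mulA aut_mul1 aut_1mul aut_mulV aut_Vmul.

Lemma aut1E x : (1%g : aut) x = x. Proof. by []. Qed.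
Lemma autM (f g : aut) x : (f * g)%g x = f (g x). Proof. by []. Qed.

Definition refl_fun (v : vertex D) (x : K0) : K0 :=
  x - alpha v *~ form x (alpha v).

Lemma refl_funK v : involutive (refl_fun v).
Proof.
move=> x; rewrite /refl_fun [in X in _ - X]formC raddfB raddfMz /=.
rewrite form_alpha gram_diag [form (alpha v) x]formC -addrA -opprD -mulrzDr.
by rewrite -[2 *~ _]mulrzr intz mulr_natl mulr2n addrA subrr mulr0z subr0.
Qed.

Lemma refl_is_aut v : is_aut (refl_fun v).
Proof.
split.
- move=> x y; rewrite /refl_fun formC raddfD /= mulrzDr opprD addrACA.
  by rewrite !(formC (alpha v)).
- by exists (refl_fun v); apply: refl_funK.
move=> x y; rewrite /refl_fun raddfB raddfMz /= formC raddfB raddfMz /=.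
rewrite [form (_ - _) _]formC raddfB raddfMz /= form_alpha gram_diag.
rewrite !(formC (alpha v)) (formC y x) !mulrz_int; ring.
Qed.

Definition refl (v : vertex D) : aut := mk_aut (refl_is_aut v).

Definition weyl_pred : {pred aut} := generated (fun g => exists v, g = refl v).

HB.instance Definition _ := GroupClosed.copy weyl_pred (generated _).

Definition weyl : Type := subgroup weyl_pred.

HB.instance Definition _ := SubGroup.copy weyl (subgroup weyl_pred).

Definition weyl_aut (w : weyl) : aut := incl weyl_pred w.
Coercion weyl_aut : weyl >-> aut.

Lemma weyl1E x : (1%g : weyl) x = x.
Proof. exact: (congr1 (fun f : aut => f x) (val1 weyl)). Qed.

Lemma weylME (g h : weyl) x : ((g * h)%g : weyl) x = g (h x).
Proof. exact: (congr1 (fun f : aut => f x) (valM g h)). Qed.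

Lemma weyl_ext (g h : weyl) : (forall x, g x = h x) -> g = h.
Proof. by move=> gh; apply/val_inj/aut_ext => x; apply: gh. Qed.

Lemma refl_in_weyl v : refl v \in weyl_pred.
Proof. by apply: mem_generated; exists v. Qed.

Definition weyl_refl (v : vertex D) : weyl := Subgroup (refl_in_weyl v).

Definition rad : {pred K0} := fun x => `[< forall y, form x y = 0 >].

Let rad_closed : zmod_closed rad.
Proof.
split; first by apply/asboolP => y; rewrite formC raddf0.
move=> x y /asboolP xP /asboolP yP; apply/asboolP => z.
by rewrite formC raddfB /= !(formC z) xP yP subrr.
Qed.

HB.instance Definition _ := GRing.isZmodClosed.Build K0 rad rad_closed.

Definition K0rad : zmodType := Quotient.quot rad.

Definition weyl_act_fun (w : weyl) (m : K0rad) : K0rad :=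
  \pi_K0rad (w (repr m)).

Lemma autB (f : aut) x y : f (x - y) = f x - f y.
Proof. by apply: (addIr (f y)); rewrite -autD !subrK. Qed.

Lemma rad_aut (f : aut) x : x \in rad -> f x \in rad.
Proof.
move=> /asboolP xP; apply/asboolP => y.
have [_ [g _ gK] _] := autP f.
by rewrite -(gK y) aut_form xP.
Qed.

Lemma K0radP (m : K0rad) : exists x, m = \pi_K0rad x.
Proof. by exists (repr m); rewrite reprK. Qed.

Lemma weyl_act_pi w x : weyl_act_fun w (\pi_K0rad x) = \pi_K0rad (w x).
Proof.
apply/eqP; rewrite -Quotient.idealrBE -autB; apply: rad_aut.
by rewrite Quotient.idealrBE reprK.
Qed.

Let weyl_act1 m : weyl_act_fun 1%g m = m.
Proof. by have [x ->] := K0radP m; rewrite weyl_act_pi weyl1E. Qed.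

Let weyl_actM g h m :
  weyl_act_fun (g * h)%g m = weyl_act_fun g (weyl_act_fun h m).
Proof. by have [x ->] := K0radP m; rewrite !weyl_act_pi weylME. Qed.

Let weyl_actD g m n :
  weyl_act_fun g (m + n) = weyl_act_fun g m + weyl_act_fun g n.
Proof.
have [x ->] := K0radP m; have [y ->] := K0radP n.
by rewrite -raddfD !weyl_act_pi autD raddfD.
Qed.

Definition weyl_act : group_action weyl K0rad :=
  GroupAction weyl_act1 weyl_actM weyl_actD.

End Lattice.

Section Octopus.
Variables (r : nat) (a : 'I_r -> nat).

(* None is the vertex 1; Some (Tagged _ j), with j : 'I_(a i).-1 counted from
   0, is the vertex (i, j + 1). *)
Definition TA : finType := option {i : 'I_r & 'I_(a i).-1}.

Definition star_gram (u v : TA) : int :=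
  match u, v with
  | None, None => 2
  | None, Some s | Some s, None => if tagged s == 0%N :> nat then -1 else 0
  | Some s, Some t =>
      if s == t then 2
      else if (tag s == tag t) &&
              (((tagged s).+1 == tagged t :> nat) ||
               ((tagged t).+1 == tagged s :> nat)) then -1
      else 0
  end.

Lemma star_gram_sym u v : star_gram u v = star_gram v u.
Proof.
case: u v => [s|] [t|] //=.
by rewrite (eq_sym s) (eq_sym (tag s)) orbC.
Qed.

Lemma star_gram_diag v : star_gram v v = 2.
Proof. by case: v => [s|] //=; rewrite eqxx. Qed.

Definition RA : root_basis := RootBasis star_gram_sym star_gram_diag.

(* None is the vertex 1^*. *)
Definition TtA : finType := option TA.

Definition octopus_gram (u v : TtA) : int :=
  match u, v with
  | Some u, Some v => star_gram u v
  | None, None => 2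
  | None, Some w | Some w, None =>
      match w with
      | None => 2
      | Some s => if tagged s == 0%N :> nat then -1 else 0
      end
  end.

Lemma octopus_gram_sym u v : octopus_gram u v = octopus_gram v u.
Proof. by case: u v => [u|] [v|] //; apply: star_gram_sym. Qed.

Lemma octopus_gram_diag v : octopus_gram v v = 2.
Proof. by case: v => [v|] //; apply: star_gram_diag. Qed.

Definition RtA : root_basis := RootBasis octopus_gram_sym octopus_gram_diag.

Definition vone : vertex RA := None.
Definition tvone : vertex RtA := Some vone.
Definition vstar : vertex RtA := None.

Definition delta : K0 RtA := alpha vstar - alpha tvone.

Definition fold (v : vertex RtA) : vertex RA := odflt vone v.

(* The quotient map of K0 RtA by Z delta; see proj_surj and proj_ker. *)
Definition proj (x : K0 RtA) : K0 RA := \sum_v alpha (fold v) *~ x v.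

Lemma proj_zmod_morphism : zmod_morphism proj.
Proof.
move=> x y; rewrite /proj -sumrB; apply: eq_bigr => v _.
by rewrite !ffunE mulrzBr.
Qed.

HB.instance Definition _ :=
  GRing.isZmodMorphism.Build (K0 RtA) (K0 RA) proj proj_zmod_morphism.

Lemma projE x : proj x = \sum_(v : vertex RA) alpha v *~ x (Some v)
                         + alpha vone *~ x vstar.
Proof.
rewrite /proj (bigD1 vstar) //= addrC; congr (_ + _).
rewrite (reindex_omap Some id) //=; last by case.
by apply: eq_bigl => v; rewrite eqxx.
Qed.

Lemma proj_coef x v :
  proj x v = x (Some v) + (if v == vone then x vstar else 0).
Proof.
rewrite projE ffunE sum_ffunE (bigD1 v) // big1.
  by rewrite !K0_mulrzE !ffunE eqxx mul1r /= addr0; case: eqP => _; rewrite ?mul1r ?mul0r.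
by move=> w /andP[_ nwv]; rewrite K0_mulrzE ffunE eq_sym (negPf nwv) mul0r.
Qed.

Lemma proj_alpha v : proj (alpha v) = alpha (fold v).
Proof.
rewrite /proj (bigD1 v) //= big1 ?addr0 ?ffunE ?eqxx //.
by move=> w nwv; rewrite ffunE (negPf nwv) mulr0z.
Qed.

Lemma proj_surj y : exists x, proj x = y.
Proof.
exists ([ffun v => if v is Some u then y u else 0] : K0 RtA).
by apply/ffunP => v; rewrite proj_coef !ffunE if_same addr0.
Qed.

Lemma proj_ker x : proj x = 0 <-> exists n : int, x = delta *~ n.
Proof.
split=> [x0 | [n ->]]; last first.
  by rewrite raddfMz raddfB /= !proj_alpha subrr mul0rz.
exists (x vstar); apply/ffunP => v; rewrite K0_mulrzE !ffunE.
case: v => [v|] /=; last by rewrite subr0 mul1r.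
have /ffunP/(_ v) := x0; rewrite proj_coef ffunE => /eqP.
rewrite addr_eq0 => /eqP ->; rewrite /tvone (inj_eq Some_inj) /=.
by case: eqP => _; rewrite ?sub0r ?mulN1r ?subr0 ?mul0r ?oppr0.
Qed.

Lemma octopus_gram_fold u v : octopus_gram u v = star_gram (fold u) (fold v).
Proof. by case: u v => [[s|]|] [[t|]|]. Qed.

Lemma form_proj x y : form (proj x) (proj y) = form x y.
Proof.
rewrite [in RHS](alpha_decomp x) [in RHS](alpha_decomp y) /proj.
rewrite !raddf_sum; apply: eq_bigr => v _; rewrite !raddfMz /=; congr (_ *~ _).
rewrite !(formC _ (alpha _)) !raddf_sum; apply: eq_bigr => u _.
by rewrite !raddfMz /= !form_alpha /= octopus_gram_fold.
Qed.

Lemma delta_rad : delta \in @rad RtA.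
Proof.
apply/asboolP => y; rewrite -form_proj raddfB /= !proj_alpha subrr.
by rewrite formC raddf0.
Qed.

Lemma proj_refl v x : proj (refl v x) = refl (fold v) (proj x).
Proof.
by rewrite /= /refl_fun raddfB raddfMz /= proj_alpha -form_proj proj_alpha.
Qed.

Lemma weyl_induced (g : weyl RtA) :
  exists h : weyl RA, forall x, h (proj x) = proj (g x).
Proof.
pose H : {pred aut RtA} := fun f =>
  `[< exists h : weyl RA, forall x, h (proj x) = proj (f x) >].
have /asboolP gW : weyl_aut g \in @weyl_pred RtA by apply: valP.
suff /asboolP : weyl_aut g \in H by [].
apply: gW.
  split; first by apply/asboolP; exists 1%g => x; rewrite weyl1E.
  move=> f k /asboolP[f' f'E] /asboolP[k' k'E]; apply/asboolP.
  exists (f' / k')%g => x.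
  have kK y : k ((k^-1)%g y) = y by rewrite -autM mulgV.
  have -> : proj x = k' (proj ((k^-1)%g x)) by rewrite k'E kK.
  by rewrite -weylME mulgVK f'E.
by move=> _ [v ->]; apply/asboolP; exists (weyl_refl (fold v)) => x ;
  apply/esym/proj_refl.
Qed.

(* The homomorphism induced by proj; see weyl_projE and weyl_proj_refl. *)
Definition weyl_proj (g : weyl RtA) : weyl RA := projT1 (cid (weyl_induced g)).

Lemma weyl_projE (g : weyl RtA) x : weyl_proj g (proj x) = proj (g x).
Proof. exact: (projT2 (cid (weyl_induced g))). Qed.

Lemma weyl_proj_unique (g : weyl RtA) (h : weyl RA) :
  (forall x, h (proj x) = proj (g x)) -> weyl_proj g = h.
Proof.
move=> hP; apply: weyl_ext => y; have [x <-] := proj_surj y.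
by rewrite weyl_projE hP.
Qed.

Lemma weyl_proj_refl v : weyl_proj (weyl_refl v) = weyl_refl (fold v).
Proof. by apply: weyl_proj_unique => x; apply/esym/proj_refl. Qed.

Let weyl_proj_morphism : {morph weyl_proj : g h / (g * h)%g}.
Proof.
move=> g h; apply: weyl_proj_unique => x.
by rewrite weylME !weyl_projE weylME.
Qed.

HB.instance Definition _ := isMultiplicative.Build (weyl RtA) (weyl RA)
  weyl_proj weyl_proj_morphism.

Definition tau1 : weyl RtA := (weyl_refl tvone * weyl_refl vstar)%g.

End Octopus.

(* Main.v *)
From HB Require Import structures.
From mathcomp Require Import all_boot all_order all_algebra.
From mathcomp Require Import boolp.
Require Import Defs.

(** Write x in the extended lattice as sec (proj x) + n delta, with n its
    coefficient at 1^*; thus K0 (RtA a) is K0 (RA a) + Z delta, and delta is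
    isotropic and orthogonal to everything.  In these coordinates every element
    of the extended Weyl group has the form

      affine w m : y + n delta |-> w y + (n - <w y, m>) delta

    with w in the Weyl group of RA and m in K0 (RA a).  These maps compose by
    affine w m * affine w' n = affine (w w') (m + w n) (affineM), which is the
    multiplication of a semidirect product, and m matters only modulo the
    radical of the form (affine_eq_mod_rad).  Hence (w, m) |-> affine w m
    embeds the semidirect product W(RA) |>< K0 / rad into the isometry group,
    and it remains to identify its image with the extended Weyl group.

    The reflection at a vertex v of the star is affine r_v 0 (affine_refl), so
    the Weyl group of RA lifts, and tau1 is the translation
    affine 1 alpha_1 (affine_tau1).  Conjugating the translation by m with the
    lift of w gives the translation by w m; therefore the normal closure of
    tau1 contains the translations by the whole subgroup spanned by the orbit
    of alpha_1.  As the star is connected, this subgroup is all of K0 (RA a)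
    (weyl_orbit_span): if u and v are adjacent, then
    alpha_v = r_v alpha_u - alpha_u.  So every affine w m lies in the extended
    Weyl group (affine_in_weyl); conversely the affine maps form a group that
    contains all the generators (of_semidirect_surj).

    Exactness follows, since proj induces affine w m |-> w: an element of the
    kernel is a translation, and all translations lie in the normal closure of
    tau1, which is itself in the kernel because tau1 is. *)

Set Implicit Arguments.
Unset Strict Implicit.
Unset Printing Implicit Defensive.

Import GRing.Theory.
Local Open Scope ring_scope.
Local Open Scope quotient_scope.

(** * Homomorphisms of groups *)

Lemma isomorphic_inverse (G H : groupType)
    (f : {multiplicative G -> H}) :
  injective f -> (forall y, exists x, f x = y) -> isomorphic H G.
Proof.
move=> f_inj f_surj; pose g y := sval (cid (f_surj y)).
have gK y : f (g y) = y by rewrite /g; case: cid.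
have gM : {morph g : x y / (x * y)%g}.
  by move=> x y; apply: f_inj; rewrite gmulfM !gK.
pose gm := isMultiplicative.Build H G g gM.
exists (HB.pack_for {multiplicative H -> G} g gm).
by exists f => // x; apply: f_inj; rewrite gK.
Qed.

Lemma multiplicative1 (G H : groupType) (f : {multiplicative G -> H}) :
  f 1%g = 1%g.
Proof.
by apply: (can_inj (mulKg (f 1%g))); rewrite -gmulfM !mulg1.
Qed.

Lemma multiplicativeF (G H : groupType) (f : {multiplicative G -> H}) :
  {morph f : x y / (x / y)%g}.
Proof.
by move=> x y; apply: (can_inj (mulgK (f y))); rewrite -gmulfM !mulgVK.
Qed.

Lemma image_group_closed (G H : groupType) (f : {multiplicative G -> H}) :
  group_closed (fun y => `[< exists x, f x = y >]).
Proof.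
split; first by apply/asboolP; exists 1%g; apply: multiplicative1.
move=> _ _ /asboolP[x <-] /asboolP[y <-].
by apply/asboolP; exists (x / y)%g; apply: multiplicativeF.
Qed.

(** * The orbit of the central simple root *)

Section Span.
Variables (r : nat) (a : 'I_r -> nat).

Lemma refl_alpha_adj (D : root_basis) (u v : vertex D) :
  gram u v = -1 -> refl v (alpha u) = alpha u + alpha v.
Proof. by move=> uv; rewrite /= /refl_fun form_alpha uv mulrNz opprK. Qed.

(** The orbit of alpha_1 under the Weyl group spans the lattice because the
    Dynkin diagram is connected: the simple roots are reached one after the
    other along each arm, starting from the centre. *)
Lemma weyl_orbit_span (P : K0 (RA a) -> Prop) :
    (forall x y, P x -> P y -> P (x - y)) ->
    (forall v x, P x -> P (refl v x)) ->
  P (alpha (vone a)) -> forall x, P x.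
Proof.
move=> PB PW P1.
have P0 : P 0 by rewrite -(subrr (alpha (vone a))); apply: PB.
have PN x : P x -> P (- x) by move=> Px; rewrite -sub0r; apply: PB.
have PD x y : P x -> P y -> P (x + y).
  by move=> Px Py; rewrite -[y]opprK; apply: PB => //; apply: PN.
have Padj u v : gram u v = -1 -> P (alpha u) -> P (alpha v).
  move=> uv Pu; have -> : alpha v = refl v (alpha u) - alpha u.
    by rewrite refl_alpha_adj // addrC addKr.
  by apply: PB => //; apply: PW.
have Palpha v : P (alpha v).
  case: v => [[i [j ltj]]|//].
  (* Position j = 0 on an arm is adjacent to the centre. *)
  elim: j ltj => [|j IHj] ltj; first exact: (@Padj (vone a)).
  apply: Padj (IHj (ltnW ltj)).
  rewrite /= eqxx /= eqxx /= ifN //.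
  apply/eqP => eq_st.
  by have /n_Sn := congr1 (fun s : {i & 'I_(a i).-1} => tagged s : nat) eq_st.
have Pnat x (n : nat) : P x -> P (x *+ n).
  by move=> Px; elim: n => // n IHn; rewrite mulrS; apply: PD.
move=> x; rewrite (alpha_decomp x); elim/big_ind: _ => // v _.
by case: (x v) => n; rewrite /intmul; [|apply: PN]; apply: Pnat.
Qed.

End Span.

(** * Affine isometries of the extended lattice *)

Section Affine.
Variables (r : nat) (a : 'I_r -> nat).
Local Notation R := (RA a).
Local Notation Rt := (RtA a).
Local Notation delta := (delta a).
Local Notation vstar := (vstar a).

Definition sec (x : K0 R) : K0 Rt := [ffun v => if v is Some u then x u else 0].

Lemma sec_zmod_morphism : zmod_morphism sec.
Proof. by move=> x y; apply/ffunP => -[v|]; rewrite !ffunE ?subr0. Qed.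

HB.instance Definition _ :=
  GRing.isZmodMorphism.Build (K0 R) (K0 Rt) sec sec_zmod_morphism.

Lemma secK x : proj (sec x) = x.
Proof. by apply/ffunP => v; rewrite proj_coef !ffunE if_same addr0. Qed.

Lemma proj_delta n : proj (delta *~ n) = 0.
Proof. by apply/proj_ker; exists n. Qed.

Lemma sec_proj_decomp x : x = sec (proj x) + delta *~ x vstar.
Proof.
have /proj_ker [n xE] : proj (x - sec (proj x)) = 0.
  by rewrite raddfB /= secK subrr.
suff -> : x vstar = n by rewrite -xE addrC subrK.
have := congr1 (fun y : K0 Rt => y vstar) xE.
by rewrite K0_mulrzE !ffunE !subr0 mul1r.
Qed.

(** The coordinates in which the identities between isometries below are
    checked; they exist because sec and delta split the extended lattice. *)
Lemma proj_vstar_ext x y : proj x = proj y -> x vstar = y vstar -> x = y.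
Proof.
by move=> pxy vxy; rewrite (sec_proj_decomp x) pxy vxy -sec_proj_decomp.
Qed.

(** The lift of f that fixes delta and preserves the copy of K0 R, followed by
    the translation y |-> y - <y, m> delta (an Eichler transvection, which is
    an isometry because delta is in the radical). *)
Definition affine_fun (f : aut R) (m : K0 R) (x : K0 Rt) : K0 Rt :=
  sec (f (proj x)) + delta *~ (x vstar - form (f (proj x)) m).

Lemma proj_affine_fun f m x : proj (affine_fun f m x) = f (proj x).
Proof. by rewrite raddfD /= secK proj_delta addr0. Qed.

Lemma affine_fun_vstar f m x :
  affine_fun f m x vstar = x vstar - form (f (proj x)) m.
Proof. by rewrite !ffunE K0_mulrzE !ffunE add0r subr0 mul1r. Qed.

Definition affine_funE := (proj_affine_fun, affine_fun_vstar).

(** The pairing of the inner translation becomes <g y, n> = <f g y, f n> by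
    invariance of the form, whence the twist of n by f. *)
Lemma affine_funM f m g n x :
  affine_fun f m (affine_fun g n x) = affine_fun (f * g)%g (m + f n) x.
Proof.
apply: proj_vstar_ext; rewrite !affine_funE ?autM //.
by rewrite raddfD /= aut_form opprD addrA addrAC.
Qed.

Lemma affine_fun1 x : affine_fun 1%g 0 x = x.
Proof.
by apply: proj_vstar_ext; rewrite !affine_funE ?aut1E // raddf0 subr0.
Qed.

Lemma aut0 (D : root_basis) (f : aut D) : f 0 = 0.
Proof. by apply: (addrI (f 0)); rewrite -autD !addr0. Qed.

Lemma affine_is_aut f m : is_aut (affine_fun f m).
Proof.
split=> [x y | | x y].
- apply: proj_vstar_ext.
    by rewrite proj_affine_fun [RHS]raddfD /= 2!proj_affine_fun raddfD /= autD.
  rewrite affine_fun_vstar [RHS]ffunE !affine_fun_vstar raddfD /= autD ffunE.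
  by rewrite !(formC _ m) raddfD /= opprD addrACA.
(* The witness solves m + f n = 0 for n, following affine_funM. *)
- exists (affine_fun f^-1%g (- (f^-1)%g m)) => x; rewrite affine_funM.
    by rewrite addNr mulVg affine_fun1.
  rewrite -[- _]sub0r autB aut0 -autM mulgV aut1E sub0r subrr.
  exact: affine_fun1.
by rewrite -form_proj !affine_funE aut_form form_proj.
Qed.

Definition affine f m : aut Rt := mk_aut (affine_is_aut f m).

Lemma affineM f m g n :
  (affine f m * affine g n)%g = affine (f * g)%g (m + f n).
Proof. by apply: aut_ext => x; apply: affine_funM. Qed.

Lemma affine1 : affine 1%g 0 = 1%g.
Proof. by apply: aut_ext => x; apply: affine_fun1. Qed.

Lemma affine_refl v : affine (refl v) 0 = refl (Some v : vertex Rt).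
Proof.
apply: aut_ext => x; apply: proj_vstar_ext.
  by rewrite proj_refl [LHS]proj_affine_fun.
rewrite [LHS]affine_fun_vstar raddf0 /= /refl_fun !ffunE K0_mulrzE ffunE.
by rewrite mul0r.
Qed.

Lemma tau1E : weyl_aut (tau1 a) = (refl (tvone a) * refl vstar)%g.
Proof. exact: valM. Qed.

(** The simple roots at 1 and 1^* differ by delta, so their reflections agree
    modulo delta and the product of the two is a translation. *)
Lemma affine_tau1 : affine 1%g (alpha (vone a)) = tau1 a.
Proof.
rewrite tau1E; apply: aut_ext => x; apply: proj_vstar_ext.
  by rewrite [LHS]proj_affine_fun autM !proj_refl /= refl_funK.
rewrite [LHS]affine_fun_vstar aut1E -[alpha _](proj_alpha vstar) form_proj.
rewrite autM /= /refl_fun !ffunE !K0_mulrzE !ffunE /=.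
by rewrite mul0r mul1r oppr0 addr0.
Qed.

(** Elements of the Weyl group of R lift because w |-> affine w 0 is
    multiplicative and sends simple reflections to simple reflections. *)
Lemma linear_in_weyl (w : weyl R) : affine w 0 \in @weyl_pred Rt.
Proof.
have /asboolP wW : weyl_aut w \in @weyl_pred R by apply: valP.
pose H : {pred aut R} := fun f => affine f 0 \in @weyl_pred Rt.
apply: (wW H) => [|f [v ->]]; last first.
  by rewrite /H unfold_in affine_refl refl_in_weyl.
split; first by rewrite /H unfold_in affine1 gpred1.
move=> f g Hf Hg.
have -> : ((f / g)%g \in H) = (affine (f / g)%g 0 \in @weyl_pred Rt) by [].
suff -> : affine (f / g)%g 0 = (affine f 0 / affine g 0)%g by apply: gpredF.
apply: (can_inj (mulgK (affine g 0))).
by rewrite mulgVK affineM aut0 addr0 mulgVK.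
Qed.

(** A section of the homomorphism induced by proj. *)
Definition lift (w : weyl R) : weyl Rt := Subgroup (linear_in_weyl w).

Local Notation N := (normal_closure (fun g : weyl Rt => g = tau1 a)).

Lemma weyl_autM (g h : weyl Rt) :
  weyl_aut (g * h)%g = (weyl_aut g * weyl_aut h)%g.
Proof. exact: valM. Qed.

Lemma weyl_aut_inj : injective (@weyl_aut Rt).
Proof. exact: val_inj. Qed.

(** The m whose translation lies in the normal closure of tau1 form a subgroup
    that contains alpha_1 and is stable under the Weyl group, as conjugation by
    the lift of w turns the translation by m into the one by w m; such a
    subgroup is everything by weyl_orbit_span. *)
Lemma translation_mem_closure (m : K0 R) :
  exists2 t : weyl Rt, t \in N & weyl_aut t = affine 1%g m.
Proof.
move: m; apply: weyl_orbit_span.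
- move=> m n [t tN tE] [u uN uE]; exists (t / u)%g; first exact: gpredF.
  apply: (can_inj (mulgK (weyl_aut u))).
  by rewrite -weyl_autM mulgVK tE uE affineM aut1E mulg1 subrK.
- move=> v m [t tN tE]; set s := lift (weyl_refl v).
  exists (t ^ s^-1)%g.
    by apply/asboolP => H Hc HJ Ht; apply: (HJ); move/asboolP: tN; apply.
  apply: (can_inj (mulgK (weyl_aut s))).
  rewrite -weyl_autM conjgE invgK -mulgA mulgVK weyl_autM tE !affineM.
  by rewrite mulg1 mul1g aut1E add0r addr0.
exists (tau1 a); last by rewrite affine_tau1.
by apply/asboolP => H _ _; apply.
Qed.

Lemma affine_in_weyl (w : weyl R) m : affine w m \in @weyl_pred Rt.
Proof.
have [t _ tE] := translation_mem_closure m.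
suff -> : affine w m = (weyl_aut t * weyl_aut (lift w))%g.
  by rewrite -weyl_autM; apply: valP.
by rewrite tE affineM mul1g aut1E addr0.
Qed.

(** The form is nondegenerate modulo its radical, and the vectors f y paired
    with m and n run over the whole lattice because f is onto. *)
Lemma affine_eq_mod_rad f m n :
  affine f m = affine f n <-> \pi_(K0rad R) m = \pi_(K0rad R) n.
Proof.
split=> [fmn | /eqP].
  apply/eqP; rewrite -Quotient.idealrBE; apply/asboolP => y.
  have [_ [g _ gK] _] := autP f.
  have := congr1 (fun h : aut Rt => h (sec (g y)) vstar) fmn.
  rewrite /= !affine_fun_vstar secK gK => /addrI /oppr_inj ymn.
  by rewrite formC raddfB /= ymn subrr.
rewrite -Quotient.idealrBE => /asboolP mn.
apply: aut_ext => x; apply: proj_vstar_ext; rewrite !affine_funE //.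
by congr (_ - _); apply/eqP; rewrite -subr_eq0 -raddfB /= formC mn.
Qed.

(** * The extended Weyl group as a semidirect product *)

Definition sdpair (w : weyl R) (m : K0 R) : semidirect (weyl_act R) :=
  (w, \pi_(K0rad R) m).

Lemma sdpairP (x : semidirect (weyl_act R)) : exists w m, x = sdpair w m.
Proof. by case: x => w m; have [n ->] := K0radP m; exists w, n. Qed.

Lemma sdpairM w m w' n :
  (sdpair w m * sdpair w' n)%g = sdpair (w * w')%g (m + w n).
Proof. by congr (_, _); rewrite /= weyl_act_pi raddfD. Qed.

(** The choice of representative is immaterial by affine_eq_mod_rad. *)
Definition of_semidirect (x : semidirect (weyl_act R)) : weyl Rt :=
  Subgroup (affine_in_weyl x.1 (repr x.2)).

Lemma of_semidirectE w m : weyl_aut (of_semidirect (sdpair w m)) = affine w m.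
Proof. by apply/affine_eq_mod_rad; rewrite reprK. Qed.

Lemma of_semidirectM : {morph of_semidirect : x y / (x * y)%g}.
Proof.
move=> x y; have [w [m ->]] := sdpairP x; have [w' [n ->]] := sdpairP y.
apply: weyl_aut_inj; rewrite sdpairM weyl_autM !of_semidirectE affineM.
by congr affine; apply: valM.
Qed.

HB.instance Definition _ := isMultiplicative.Build
  (semidirect (weyl_act R)) (weyl Rt) of_semidirect of_semidirectM.

Lemma weyl_proj_of_semidirect x : weyl_proj (of_semidirect x) = x.1.
Proof.
by apply: weyl_proj_unique => y; rewrite proj_affine_fun.
Qed.

Lemma of_semidirect_inj : injective of_semidirect.
Proof.
move=> x y; have [w [m ->]] := sdpairP x; have [w' [n ->]] := sdpairP y => xy.
have ww' : w = w'.
  by have := congr1 (@weyl_proj r a) xy; rewrite !weyl_proj_of_semidirect.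
move: xy; rewrite -{}ww' => /(congr1 (@weyl_aut _)).
by rewrite !of_semidirectE /sdpair => /affine_eq_mod_rad ->.
Qed.

(** The image is a group that contains the simple reflections: at the vertices
    of the star by affine_refl, and at 1^* because r_{1^*} = r_1 tau1. *)
Lemma of_semidirect_surj g : exists x, of_semidirect x = g.
Proof.
have /asboolP gW : weyl_aut g \in @weyl_pred Rt by apply: valP.
pose f : {multiplicative semidirect (weyl_act R) -> aut Rt} :=
  incl (@weyl_pred Rt) \o of_semidirect.
have fE w m : f (sdpair w m) = affine w m by apply: of_semidirectE.
suff /asboolP[x xE] : weyl_aut g \in (fun y => `[< exists x, f x = y >]).
  by exists x; apply: weyl_aut_inj.
apply: gW (image_group_closed f) _ => _ [[v|] ->]; apply/asboolP.
  by exists (sdpair (weyl_refl (v : vertex R)) 0); rewrite fE affine_refl.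
exists (sdpair (weyl_refl (vone a)) 0 * sdpair 1%g (alpha (vone a)))%g.
rewrite gmulfM !fE affine_refl [X in (_ * X)%g]affine_tau1.
by apply: aut_ext => x; rewrite autM tau1E autM; apply: refl_funK.
Qed.

(** * The kernel of the projection *)

Lemma ker_proj_sub_closure g : weyl_proj g = 1%g -> g \in N.
Proof.
have [x <-] := of_semidirect_surj g; have [w [m ->]] := sdpairP x.
rewrite weyl_proj_of_semidirect /= => ->.
have [t tN tE] := translation_mem_closure m.
suff -> : of_semidirect (sdpair 1%g m) = t by [].
by apply: weyl_aut_inj; rewrite of_semidirectE tE.
Qed.

Lemma closure_sub_ker_proj g : g \in N -> weyl_proj g = 1%g.
Proof.
move/asboolP => gN; pose H : {pred weyl Rt} := fun h => weyl_proj h == 1%g.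
apply/eqP; apply: (gN H).
- split; first by apply/eqP; apply: multiplicative1.
  move=> x y /eqP x1 /eqP y1; apply/eqP.
  by rewrite (multiplicativeF (@weyl_proj r a)) /= x1 y1 divg1.
- move=> h k /eqP h1; apply/eqP.
  by rewrite conjgE !gmulfM /= h1 mul1g -gmulfM mulVg; apply: multiplicative1.
move=> _ ->; apply/eqP; rewrite gmulfM /= !weyl_proj_refl.
by apply: weyl_ext => x; rewrite weylME weyl1E; apply: refl_funK.
Qed.

End Affine.

Theorem theorem3p5 (r : nat) (a : 'I_r -> nat)
    (r_ge3 : (3 <= r)%N) (a_ge2 : forall i, (2 <= a i)%N) :
  short_exact (incl (normal_closure (fun g : weyl (RtA a) => g = tau1 a)))
              (@weyl_proj r a)
  /\ isomorphic (weyl (RtA a)) (semidirect (weyl_act (RA a))).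
Proof.
split; last first.
  exact: isomorphic_inverse (@of_semidirect_inj r a) (@of_semidirect_surj r a).
split=> y.
- split=> [y1 | [u <-]]; last exact: (multiplicative1 (incl _)).
  by exists tt; apply: val_inj; rewrite y1.
- split=> [/ker_proj_sub_closure yN | [[x xN] <-]].
    by exists (Subgroup yN).
  exact: closure_sub_ker_proj.
split=> // _; exists (of_semidirect (y, 0)); exact: weyl_proj_of_semidirect.
Qed.
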